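(* Let $n$ and $k\geq 2$ be positive integers, let $P=(p_1,\dots,p_k)$ be a probability distribution on $\{1,\dots,k\}$, let $X=(X_1,\dots,X_k)$ be multinomially distributed with $n$ samples and probabilities $P$, and let $V_{n,k,P}=D\big((X_1/n,\dots,X_k/n)\,\|\,(p_1,\dots,p_k)\big)$. Then for all real $\varepsilon>\frac{k-1}{n}$, \[ \Pr\big[V_{n,k,P}\geq \varepsilon\big]\leq e^{-n\varepsilon}\cdot\left(\frac{e\varepsilon n}{k-1}\right)^{k-1}. \]
   Context: For probability distributions $(q_1,\dots,q_k)$ and $(p_1,\dots,p_k)$ on a finite set, the Kullback--Leibler divergence is $D\big((q_1,\dots,q_k)\,\|\,(p_1,\dots,p_k)\big)=\sum_{i=1}^k q_i\log\frac{q_i}{p_i}$, with natural logarithm and the usual conventions $0\log(0/p)=0$. The quantity $V_{n,k,P}$ is the divergence from $P$ to the empirical distribution of $n$ i.i.d. samples from $P$. *)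

(* Defs.v *)
From mathcomp Require Import all_boot all_order all_algebra.
From mathcomp Require Import reals sequences exp.
Set Implicit Arguments. Unset Strict Implicit. Unset Printing Implicit Defensive.
Import Order.TTheory GRing.Theory Num.Theory.
Local Open Scope ring_scope.

Definition KL (R : realType) (k : nat) (q p : 'I_k -> R) : R :=
  \sum_(i < k) (if q i == 0 then 0 else q i * ln (q i / p i)).

(* Outcomes of a multinomial experiment with n samples over k categories:
   count vectors x with x_i in {0..n} and sum_i x_i = n. *)
Definition is_count (k n : nat) (x : {ffun 'I_k -> 'I_n.+1}) : bool :=
  (\sum_(i < k) (x i : nat))%N == n.

Definition multinomial_pmf (R : realType) (k n : nat) (p : 'I_k -> R)
  (x : {ffun 'I_k -> 'I_n.+1}) : R :=
  (n`!)%:R / (\prod_(i < k) ((x i)`!)%:R) * \prod_(i < k) p i ^+ (x i).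

Definition empirical (R : realType) (k n : nat) (x : {ffun 'I_k -> 'I_n.+1})
  : 'I_k -> R := fun i => (x i : nat)%:R / n%:R.

Definition V (R : realType) (k n : nat) (p : 'I_k -> R)
  (x : {ffun 'I_k -> 'I_n.+1}) : R := KL (empirical R x) p.

Definition prob_V_ge (R : realType) (k n : nat) (p : 'I_k -> R) (eps : R) : R :=
  \sum_(x : {ffun 'I_k -> 'I_n.+1} | is_count x && (eps <= V p x))
     multinomial_pmf p x.

(* Main.v *)
(* Chernoff's method with [lam = 1 - (k-1)/(n eps)] reduces the theorem to
   [E exp(lam n V) <= (1 - lam)^-(k-1)].  Weighted AM-GM,
   [p^(1-lam) q^lam <= (1-lam) p + lam q], bounds the left side by
     [\sum_x n! / \prod_i x_i! * \prod_i ((1-lam) p_i + x_i lam/n)^x_i],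
   which is [n!] times the n-th coefficient of a product of the series
   [\sum_m (a + m z)^m / m! X^m] with [a = (1-lam) p_i] and [z = lam/n].
   Abel's identity rewrites the product of two such series as a geometric sum
   of single ones, so merging the factors one by one costs a factor at most
   [1/(1-lam)] each time. *)
Require Import Defs.
From mathcomp Require Import all_boot all_order all_algebra.
From mathcomp Require Import ring lra.
From mathcomp Require Import reals sequences exp.
Import Order.TTheory GRing.Theory Num.Theory.
Local Open Scope ring_scope.
Set Implicit Arguments. Unset Strict Implicit. Unset Printing Implicit Defensive.

(** * Finite differences and Abel's identity *)

(** An N-th finite difference with step [z] kills degrees below [N]; the sign [(-1) ^+ m] turns [z]
    into [- z]. The induction splits off one factor [a + m z] and absorbs [m] into the binomial
    coefficient, which lowers [N] and shifts [a] to [a + z]. *)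
Lemma sum_bin_sign_expr (F : comPzRingType) (z a : F) (N d : nat) : (d <= N)%N ->
  \sum_(m < N.+1) 'C(N, m)%:R * (-1) ^+ m * (a + m%:R * z) ^+ d =
  (d == N)%:R * N`!%:R * (- z) ^+ N.
Proof.
elim: d N a => [|d IHd] N a.
  move=> _; transitivity ((1 - 1 : F) ^+ N).
    rewrite exprDn; apply: eq_bigr => m _.
    by rewrite expr0 expr1n mul1r mulr1 mulr_natl.
  by rewrite subrr expr0n eq_sym; case: N => [|N] //=; rewrite ?mul0r // fact0 !mulr1.
case: N => // N; rewrite ltnS => leN.
transitivity (a * (\sum_(m < N.+2) 'C(N.+1, m)%:R * (-1) ^+ m * (a + m%:R * z) ^+ d)
  - z * N.+1%:R * \sum_(m < N.+1) 'C(N, m)%:R * (-1) ^+ m * ((a + z) + m%:R * z) ^+ d).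
  transitivity (a * (\sum_(m < N.+2) 'C(N.+1, m)%:R * (-1) ^+ m * (a + m%:R * z) ^+ d)
    + z * \sum_(m < N.+2) m%:R * 'C(N.+1, m)%:R * (-1) ^+ m * (a + m%:R * z) ^+ d).
    rewrite !mulr_sumr -big_split /=; apply: eq_bigr => m _; rewrite exprS; ring.
  congr (_ + _); rewrite big_ord_recl /= !mul0r add0r -mulNr.
  rewrite !mulr_sumr; apply: eq_bigr => m _.
  rewrite /bump /= add1n -natrM -mul_bin_diag natrM exprS.
  have -> : a + m.+1%:R * z = a + z + m%:R * z by rewrite -natr1; ring.
  ring.
rewrite (IHd _ a (leqW leN)) (IHd _ (a + z) leN) eqSS.
have -> : (d == N.+1) = false by apply/negbTE; rewrite neq_ltn ltnS leN.
by rewrite factS natrM exprS mulr0n; ring.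
Qed.

Section Abel.
Variables (F : numFieldType) (z : F).

Definition abel_term (a : F) (m : nat) : F := (a + m%:R * z) ^+ m / m`!%:R.
(* Only the coefficients up to [N] of the exponential series matter. *)
Definition abel_poly (N : nat) (a : F) : {poly F} := \poly_(m < N.+1) abel_term a m.

Let fact_neq0 n : n`!%:R != 0 :> F.
Proof. by rewrite pnatr_eq0 -lt0n fact_gt0. Qed.

Lemma sum_abel_term (a b : F) (n : nat) :
  \sum_(m < n.+1) abel_term a m * abel_term b (n - m) =
  \sum_(j < n.+1) z ^+ j * ((a + b + n%:R * z) ^+ (n - j) / (n - j)`!%:R).
Proof.
(* Writing [b + (n - m) z = w - (a + m z)] and expanding in powers of [w] turns
   each coefficient into a j-th finite difference of [X^j] with step [z]. *)
pose w := a + b + n%:R * z.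
(* Padding the triangle m + l <= n by zeros to a square makes the exchange of sums immediate. *)
pose G m l := if (m + l <= n)%N then abel_term a m *
   ((- (a + m%:R * z)) ^+ (n - m - l) * w ^+ l / ((n - m - l)`!%:R * l`!%:R)) else 0.
transitivity (\sum_(m < n.+1) \sum_(l < n.+1) G m l).
  apply: eq_bigr => m _; have lem : (m <= n)%N by rewrite -ltnS.
  rewrite {2}/abel_term.
  have -> : b + (n - m)%:R * z = - (a + m%:R * z) + w by rewrite natrB // /w; ring.
  rewrite exprDn mulr_suml mulr_sumr (@big_ord_widen _ _ _ (n - m).+1 n.+1
    (fun l => abel_term a m * ((- (a + m%:R * z)) ^+ (n - m - l) * w ^+ l
       *+ 'C(n - m, l) / (n - m)`!%:R))); last by rewrite ltnS leq_subr.
  rewrite big_mkcond; apply: eq_bigr => l _; rewrite /G ltnS leq_subRL //=.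
  case: ifP => // leml; congr (_ * _).
  have lel : (l <= n - m)%N by rewrite leq_subRL.
  have /(congr1 (fun x : nat => x%:R : F)) := bin_fact lel.
  rewrite !natrM => binE.
  rewrite -(mulr_natr (_ * _)); apply: (canLR (mulfK _)) => //.
  rewrite -binE; field; by rewrite !fact_neq0.
(* From here j = n - l, so [w] carries the power n - j and the sum over m is a j-th difference. *)
rewrite exchange_big /= (reindex_inj rev_ord_inj) /=.
apply: eq_bigr => j _; rewrite subSS; have lej : (j <= n)%N by rewrite -ltnS.
rewrite -/w.
transitivity (w ^+ (n - j) / (n - j)`!%:R * (j`!%:R^-1 * (-1) ^+ j *
  \sum_(m < j.+1) 'C(j, m)%:R * (-1) ^+ m * (a + m%:R * z) ^+ j)).
  rewrite [X in _ = _ * (_ * X)](@big_ord_widen _ _ _ j.+1 n.+1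
    (fun m => 'C(j, m)%:R * (-1) ^+ m * (a + m%:R * z) ^+ j)); last by rewrite ltnS.
  rewrite mulr_sumr mulr_sumr [RHS]big_mkcond; apply: eq_bigr => m _ /=.
  have -> : (m < j.+1)%N = (m + (n - j) <= n)%N.
    by rewrite ltnS addnC -leq_subRL ?leq_subr // subKn.
  rewrite /G; case: ifP => // lemj.
  have {lemj} lemj : (m <= j)%N by rewrite addnC -leq_subRL ?leq_subr // subKn in lemj.
  have -> : (n - m - (n - j) = j - m)%N by rewrite subnAC subKn.
  rewrite /abel_term -[- (a + _)]mulN1r exprMn.
  have -> : (a + m%:R * z) ^+ j = (a + m%:R * z) ^+ m * (a + m%:R * z) ^+ (j - m).
    by rewrite -exprD subnKC.
  have -> : (-1 : F) ^+ (j - m) = (-1) ^+ j * (-1) ^+ m.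
    by rewrite -[in RHS](subnK lemj) exprD -mulrA -expr2 sqrr_sign mulr1.
  have /(congr1 (fun x : nat => x%:R : F)) := bin_fact lemj.
  rewrite !natrM => binE.
  have -> : 'C(j, m)%:R = j`!%:R / (m`!%:R * (j - m)`!%:R) :> F.
    by rewrite -binE mulfK // mulf_neq0.
  field; by rewrite !fact_neq0.
rewrite sum_bin_sign_expr // eqxx mul1r (exprNn z).
rewrite (_ : _^-1 * _ * _ = z ^+ j) 1?mulrC //.
have s2 : (-1 : F) ^+ j * (-1) ^+ j = 1 by rewrite -expr2 sqrr_sign.
transitivity (((-1 : F) ^+ j * (-1) ^+ j) * z ^+ j); last by rewrite s2 mul1r.
move: ((-1) ^+ j) => s; by field.
Qed.


Lemma coef_abel_poly (N m : nat) (a : F) : (m <= N)%N ->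
  (abel_poly N a)`_m = abel_term a m.
Proof. by move=> lemN; rewrite coef_poly ltnS lemN. Qed.

(** Since a + b + m z = (a + b + j z) + (m - j) z, each term of Abel's identity is again a
    coefficient of a single series, with shifted parameter. The spectator [q] holds the factors
    still to be merged. *)
Lemma coef_abel_polyM (N n : nat) (a b : F) (q : {poly F}) : (n <= N)%N ->
  (abel_poly N a * abel_poly N b * q)`_n =
  \sum_(j < n.+1) z ^+ j * (abel_poly N (a + b + j%:R * z) * q)`_(n - j).
Proof.
move=> lenN.
pose p := \sum_(j < n.+1) z ^+ j *: ('X^j * abel_poly N (a + b + j%:R * z)).
have eqp m : (m <= n)%N -> (abel_poly N a * abel_poly N b)`_m = p`_m.
  move=> lemn; rewrite coefM coef_sum.
  transitivity (\sum_(i < m.+1) abel_term a i * abel_term b (m - i)).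
    apply: eq_bigr => i _; have lei : (i <= m)%N by rewrite -ltnS.
    by rewrite !coef_abel_poly // (leq_trans _ lenN) // (leq_trans _ lemn) // leq_subr.
  rewrite sum_abel_term.
  rewrite (@big_ord_widen _ _ _ m.+1 n.+1
    (fun j => z ^+ j * ((a + b + m%:R * z) ^+ (m - j) / (m - j)`!%:R))) ?ltnS //.
  rewrite big_mkcond; apply: eq_bigr => j _ /=.
  rewrite coefZ coefXnM ltnS; case: leqP => [lejm|_]; last by rewrite mulr0.
  rewrite coef_abel_poly ?(leq_trans (leq_subr _ _)) ?(leq_trans lemn) //.
  rewrite /abel_term natrB //; congr (_ * (_ ^+ _ / _)); ring.
transitivity (p * q)`_n.
  by rewrite !coefM; apply: eq_bigr => i _; rewrite eqp // -ltnS.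
rewrite mulr_suml coef_sum; apply: eq_bigr => j _.
by rewrite -scalerAl coefZ -mulrA coefXnM ltnNge -ltnS ltn_ord.
Qed.

End Abel.

(** * Coefficients of products of Abel series *)

Lemma fact_le_expn_fact (n j : nat) : (j <= n)%N -> (n`! <= n ^ j * (n - j)`!)%N.
Proof.
elim: j => [|j IHj] ltjn; first by rewrite mul1n subn0.
apply: leq_trans (IHj (ltnW ltjn)) _.
rewrite -(subnSK ltjn) factS expnSr -mulnA leq_mul2l leq_mul2r subnSK //.
by rewrite leq_subr !orbT.
Qed.

(** Induction on [s], merging its head into [a]: the shift by j z raises [A] but leaves [W] fixed,
    as the degree drops by j. With n! / (n - j)! <= n^j, the terms are dominated by a geometric sum
    costing one factor [W / A]. *)
Lemma coef_prod_abel_poly_le (F : realFieldType) (z : F) (N n : nat) (a : F) (s : seq F) :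
  (n <= N)%N -> 0 <= z -> 0 <= a -> all (fun b => 0 <= b) s ->
  0 < a + \sum_(b <- s) b ->
  let A := a + \sum_(b <- s) b in let W := A + n%:R * z in
  (abel_poly z N a * \prod_(b <- s) abel_poly z N b)`_n <=
    W ^+ n / n`!%:R * (W / A) ^+ size s.
Proof.
move=> + z_ge0; elim: s a n => [|b s IHs] a n lenN a_ge0 /=.
  by rewrite !big_nil addr0 mulr1 coef_abel_poly // expr0 mulr1.
case/andP=> b_ge0 s_ge0; rewrite !big_cons mulrA coef_abel_polyM //.
rewrite addrA; set A := a + b + _ => A_gt0; set W := A + _.
have nz_ge0 : 0 <= n%:R * z by rewrite mulr_ge0.
have leAW : A <= W by rewrite lerDl.
have W_gt0 : 0 < W by apply: lt_le_trans leAW.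
have WA_ge0 : 0 <= W / A by rewrite divr_ge0 // ltW.
pose G j := (n%:R * z) ^+ j * W ^+ (n - j) / n`!%:R * (W / A) ^+ size s.
apply: (@le_trans _ _ (\sum_(j < n.+1) G j)).
  apply: ler_sum => j _; have lej : (j <= n)%N by rewrite -ltnS.
  have jz_ge0 : 0 <= j%:R * z by rewrite mulr_ge0.
  have eqA : a + b + j%:R * z + \sum_(c <- s) c = A + j%:R * z by rewrite /A; ring.
  have eqW : A + j%:R * z + (n - j)%:R * z = W.
    by rewrite -addrA -mulrDl -natrD subnKC.
  have Aj_gt0 : 0 < A + j%:R * z by rewrite ltr_pwDl.
  have := IHs (a + b + j%:R * z) (n - j)%N; rewrite /= eqA eqW.
  move=> /(_ _ _ s_ge0 Aj_gt0) IH.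
  apply: le_trans (ler_wpM2l (exprn_ge0 j z_ge0) (IH _ _)) _.
  - by rewrite (leq_trans (leq_subr _ _)).
  - by rewrite !addr_ge0.
  rewrite /G mulrA ler_pM ?exprn_ge0 ?mulr_ge0 ?invr_ge0 ?exprn_ge0 ?(ltW W_gt0) //.
  - exact: ltW.
  - rewrite exprMn [_ * z ^+ j]mulrC -!mulrA ler_wpM2l ?exprn_ge0 //.
    rewrite mulrCA ler_wpM2l ?exprn_ge0 ?(ltW W_gt0) //.
    rewrite ler_pdivlMr ?ltr0n ?fact_gt0 // mulrC ler_pdivrMr ?ltr0n ?fact_gt0 //.
    by rewrite -natrX -natrM ler_nat fact_le_expn_fact.
  apply: lerXn2r; rewrite ?nnegrE //; first by rewrite divr_ge0 // ltW.
  by rewrite ler_wpM2l ?(ltW W_gt0) // lef_pV2 ?posrE // lerDl.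
rewrite /G -!mulr_suml exprS mulrA ler_wpM2r ?exprn_ge0 //.
rewrite mulrAC ler_wpM2r ?invr_ge0 //.
have -> : A = W - n%:R * z by rewrite /W addrK.
rewrite mulrA -exprSr ler_pdivlMr; last by rewrite /W addrK.
(* The geometric sum times W - n z = A is W^(n+1) - (n z)^(n+1), hence at most W^(n+1). *)
have := subrXX W (n%:R * z) n.+1.
rewrite /= (eq_bigr (fun j : 'I__ => (n%:R * z) ^+ j * W ^+ (n - j))); last first.
  by move=> j _; rewrite mulrC.
by move=> eqX; rewrite [leLHS]mulrC -eqX lerBlDr lerDl exprn_ge0.
Qed.

(** Expanding the product picks one monomial per factor, that is a function [x]; the coefficient of
    X^n retains the count vectors. *)
Lemma sum_is_count_abel (F : numFieldType) (k n : nat) (z : F) (a : 'I_k -> F) :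
  \sum_(x : {ffun 'I_k -> 'I_n.+1} | is_count x)
     (n`!)%:R / (\prod_(i < k) ((x i)`!)%:R) *
       \prod_(i < k) (a i + (x i)%:R * z) ^+ (x i) =
  n`!%:R * (\prod_(i < k) abel_poly z n (a i))`_n.
Proof.
rewrite /abel_poly (eq_bigr (fun i => \sum_(m < n.+1) abel_term z (a i) m *: 'X^m));
  last by move=> i _; rewrite poly_def.
rewrite bigA_distr_bigA coef_sum mulr_sumr big_mkcond; apply: eq_bigr => x _ /=.
rewrite scaler_prod -expr_sum coefZ coefXn eq_sym /is_count.
case: eqP => _; last by rewrite !mulr0.
by rewrite mulr1 prodf_div mulrAC mulrA.
Qed.

Lemma sum_is_count_abel_le (F : realFieldType) (k n : nat) (z : F) (a : 'I_k.+1 -> F) :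
  0 <= z -> (forall i, 0 <= a i) -> 0 < \sum_i a i ->
  \sum_(x : {ffun 'I_k.+1 -> 'I_n.+1} | is_count x)
     (n`!)%:R / (\prod_(i < k.+1) ((x i)`!)%:R) *
       \prod_(i < k.+1) (a i + (x i)%:R * z) ^+ (x i) <=
  (\sum_i a i + n%:R * z) ^+ n * ((\sum_i a i + n%:R * z) / \sum_i a i) ^+ k.
Proof.
move=> z_ge0 a_ge0; rewrite sum_is_count_abel !big_ord_recl.
(* The factor at [ord0] seeds the merging, so only [k] merges are paid for. *)
pose s := [seq a (lift ord0 i) | i <- enum 'I_k].
have -> : \prod_(i < k) abel_poly z n (a (lift ord0 i)) = \prod_(b <- s) abel_poly z n b.
  by rewrite big_map big_enum.
have -> : \sum_(i < k) a (lift ord0 i) = \sum_(b <- s) b by rewrite big_map big_enum.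
have sz : size s = k by rewrite size_map size_enum_ord.
move=> A_gt0; rewrite mulrC -ler_pdivlMr ?ltr0n ?fact_gt0 // mulrAC -{5}sz.
apply: coef_prod_abel_poly_le => //.
by apply/allP => _ /mapP [i _ ->].
Qed.

(** * Weighted AM-GM and the exponential moment of the divergence *)

(** Concavity of [ln]: the bound ln x <= x - 1 is taken at r / t and 1 / t with weights [l] and 1 -
    l. The right sides cancel because [t] is the weighted mean of [r] and 1. *)
Lemma expR_mul_ln_le (R : realType) (l r : R) : 0 <= l <= 1 -> 0 < r ->
  expR (l * ln r) <= 1 - l + l * r.
Proof.
case/andP=> l_ge0 l_le1 r_gt0; set t := 1 - l + l * r.
have t_gt0 : 0 < t.
  rewrite /t; have [->|l_neq0] := eqVneq l 0; first lra.
  have : 0 < l * r by rewrite mulr_gt0 // lt_def l_neq0.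
  lra.
have ln_le (x : R) : 0 < x -> ln x <= x - 1.
  by move=> x_gt0; rewrite -{1}[x](subrK 1) addrC le_ln1Dx //; lra.
have h1 := ln_le _ (divr_gt0 r_gt0 t_gt0).
have h2 := ln_le _ (divr_gt0 (@ltr01 R) t_gt0).
rewrite ln_div ?posrE // in h1; rewrite ln_div ?posrE // ln1 in h2.
rewrite -[leRHS]lnK ?posrE // ler_expR.
have h3 : l * (ln r - ln t) + (1 - l) * (0 - ln t) <=
    l * (r / t - 1) + (1 - l) * (1 / t - 1).
  by rewrite lerD // ler_wpM2l // subr_ge0.
have h4 : l * (r / t - 1) + (1 - l) * (1 / t - 1) = 0.
  have -> : l * (r / t - 1) + (1 - l) * (1 / t - 1) = t / t - 1.
    by rewrite {3}/t; field; rewrite gt_eqF.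
  by rewrite divff ?gt_eqF // subrr.
lra.
Qed.

Lemma mul_expR_ln_div_le (R : realType) (l p q : R) : 0 <= l <= 1 -> 0 < p -> 0 < q ->
  p * expR (l * ln (q / p)) <= (1 - l) * p + q * l.
Proof.
move=> l01 p_gt0 q_gt0.
have -> : (1 - l) * p + q * l = p * (1 - l + l * (q / p)) by field; rewrite gt_eqF.
by rewrite ler_wpM2l ?(ltW p_gt0) // expR_mul_ln_le // divr_gt0.
Qed.

Lemma multinomial_pmf_ge0 (R : realType) (k n : nat) (p : 'I_k -> R)
  (x : {ffun 'I_k -> 'I_n.+1}) : (forall i, 0 <= p i) -> 0 <= multinomial_pmf p x.
Proof.
move=> p_ge0; rewrite /multinomial_pmf mulr_ge0 ?divr_ge0 ?prodr_ge0 //.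
by move=> i _; rewrite exprn_ge0.
Qed.

(** The exponential factors over the coordinates into x_i-th powers, so AM-GM applies to the base of
    each power. *)
Lemma multinomial_pmf_expR_V_le (R : realType) (k n : nat) (p : 'I_k -> R) (l : R)
  (x : {ffun 'I_k -> 'I_n.+1}) : (0 < n)%N -> (forall i, 0 <= p i) -> 0 <= l <= 1 ->
  multinomial_pmf p x * expR (l * n%:R * V p x) <=
  (n`!)%:R / (\prod_(i < k) ((x i)`!)%:R) *
    \prod_(i < k) ((1 - l) * p i + (x i)%:R * (l / n%:R)) ^+ (x i).
Proof.
move=> n_gt0 p_ge0 l01; have /andP [l_ge0 l_le1] := l01.
rewrite /multinomial_pmf /V /KL -[leLHS]mulrA; apply: ler_wpM2l.
  by rewrite divr_ge0 ?prodr_ge0.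
rewrite mulr_sumr expR_sum -big_split /=; apply: ler_prod => i _.
rewrite mulr_ge0 ?exprn_ge0 ?expR_ge0 //= /empirical.
have nR_gt0 : 0 < n%:R :> R by rewrite ltr0n.
have [x0|x_gt0] := posnP (x i).
  by rewrite x0 mul0r eqxx mulr0 expR0 mulr1 !expr0.
have q_gt0 : 0 < (x i)%:R / n%:R :> R by rewrite divr_gt0 // ltr0n.
rewrite gt_eqF //.
(* Here [V] is junk ([ln (q / 0) = ln 0 = 0]) but the probability vanishes. *)
have [p0|p_neq0] := eqVneq (p i) 0.
  rewrite p0 expr0n gtn_eqF // mul0r exprn_ge0 //.
  by rewrite mulr0 add0r mulr_ge0 // divr_ge0.
have p_gt0 : 0 < p i by rewrite lt_def p_neq0 p_ge0.
have -> : l * n%:R * ((x i)%:R / n%:R * ln ((x i)%:R / n%:R / p i)) =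
    (x i)%:R * (l * ln ((x i)%:R / n%:R / p i)) by field; rewrite gt_eqF.
rewrite expRM_natl -exprMn lerXn2r ?nnegrE //.
- by rewrite mulr_ge0 ?expR_ge0.
- by apply: addr_ge0; apply: mulr_ge0; rewrite ?divr_ge0 ?subr_ge0.
have -> : (x i)%:R * (l / n%:R) = (x i)%:R / n%:R * l by rewrite mulrA mulrAC.
exact: mul_expR_ln_div_le.
Qed.

Lemma mgf_V_le (R : realType) (n k : nat) (p : 'I_k.+1 -> R) (l : R) :
  (0 < n)%N -> (forall i, 0 <= p i) -> \sum_i p i = 1 -> 0 <= l < 1 ->
  \sum_(x : {ffun 'I_k.+1 -> 'I_n.+1} | is_count x)
     multinomial_pmf p x * expR (l * n%:R * V p x) <= (1 - l)^-1 ^+ k.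
Proof.
move=> n_gt0 p_ge0 sum_p /andP [l_ge0 l_lt1].
have l01 : 0 <= l <= 1 by rewrite l_ge0 ltW.
apply: le_trans (ler_sum _ (fun x _ => multinomial_pmf_expR_V_le x n_gt0 p_ge0 l01)) _.
have sum_a : \sum_i (1 - l) * p i = 1 - l by rewrite -mulr_sumr sum_p mulr1.
(* With z = l / n the total [W] is 1, so only the powers of 1 / (1 - l) survive. *)
have W1 : 1 - l + n%:R * (l / n%:R) = 1.
  by rewrite mulrC divfK ?subrK // pnatr_eq0 -lt0n.
have := @sum_is_count_abel_le R k n (l / n%:R) (fun i => (1 - l) * p i).
rewrite sum_a W1 expr1n !mul1r; apply.
- by rewrite divr_ge0.
- by move=> i; rewrite mulr_ge0 // subr_ge0 ltW.
- by rewrite subr_gt0.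
Qed.

(** * Chernoff bound and choice of the exponent *)

Lemma prob_V_ge_chernoff (R : realType) (n k : nat) (p : 'I_k.+1 -> R) (eps l : R) :
  (0 < n)%N -> (forall i, 0 <= p i) -> \sum_i p i = 1 -> 0 <= l < 1 ->
  prob_V_ge n p eps <= expR (- (l * n%:R * eps)) * (1 - l)^-1 ^+ k.
Proof.
move=> n_gt0 p_ge0 sum_p l01; have /andP [l_ge0 l_lt1] := l01.
apply: le_trans (ler_wpM2l (expR_ge0 _) (mgf_V_le n_gt0 p_ge0 sum_p l01)).
rewrite /prob_V_ge big_mkcondr mulr_sumr; apply: ler_sum => x _.
have pmf_ge0 := multinomial_pmf_ge0 x p_ge0.
rewrite mulrCA -expRD; case: ifP => [le_eps|_]; last by rewrite mulr_ge0 ?expR_ge0.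
(* Markov's inequality: on the event, exp(l n (V - eps)) >= 1. *)
rewrite ler_peMr // -[leLHS]expR0 ler_expR addrC -mulrBr.
by rewrite !mulr_ge0 // subr_ge0.
Qed.

Theorem theorem1p2 (R : realType) (n k : nat) (p : 'I_k -> R) (eps : R) :
  (0 < n)%N -> (2 <= k)%N ->
  (forall i, 0 <= p i) -> \sum_(i < k) p i = 1 ->
  (k.-1)%:R / n%:R < eps ->
  prob_V_ge n p eps <=
    expR (- (n%:R * eps)) * (expR 1 * eps * n%:R / (k.-1)%:R) ^+ k.-1.
Proof.
case: k p => [|k] p // n_gt0; rewrite ltnS => k_gt0 p_ge0 sum_p /= lt_eps.
have nR_gt0 : 0 < n%:R :> R by rewrite ltr0n.
have kR_gt0 : 0 < k%:R :> R by rewrite ltr0n.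
have eps_gt0 : 0 < eps by apply: le_lt_trans lt_eps; rewrite divr_ge0.
have ne_gt0 : 0 < n%:R * eps by rewrite mulr_gt0.
(* This minimises exp(- l n eps) (1 - l)^(-k), where [k] is now one less than the number of
   categories; [lt_eps] makes it positive. *)
pose l := 1 - k%:R / (n%:R * eps).
have l01 : 0 <= l < 1.
  rewrite subr_ge0 ltrBlDr ltrDl divr_gt0 // andbT ler_pdivrMr // mul1r.
  by rewrite mulrC -ler_pdivrMr // ltW.
apply: le_trans (prob_V_ge_chernoff eps n_gt0 p_ge0 sum_p l01) _.
have -> : - (l * n%:R * eps) = - (n%:R * eps) + k%:R * 1.
  by rewrite /l; field; rewrite !gt_eqF.
rewrite expRD expRM_natl -mulrA -exprMn.
have -> : (1 - l)^-1 = eps * n%:R / k%:R.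
  by rewrite /l; field; rewrite !gt_eqF.
by rewrite !mulrA.
Qed.
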